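(* Let $T$ be any universal theory in a language $\mathcal L$ containing only predicate symbols. Then there exists a canonical theory $T'$ that is isomorphic to $T$, i.e., there exist open interpretations $I$ of $T$ in $T'$ and $J$ of $T'$ in $T$ such that $J\circ I$ is equivalent to the identity interpretation of $T$ and $I\circ J$ is equivalent to the identity interpretation of $T'$.
   Context: A language $\mathcal L$ is a finite set of predicate symbols, each $P\in\mathcal L$ having an arity $k(P)\ge 1$ (no constants or function symbols; equality is allowed in formulas). A universal theory $T$ in $\mathcal L$ is a set of universal formulas $\forall x_1\cdots\forall x_n F(x_1,\dots,x_n)$ with $F$ open (quantifier-free), called axioms. A theory $T$ is canonical if for every $P\in\mathcal L$ of arity $k$ and every $1\le i<j\le k$, $T$ entails $x_i=x_j\to\neg P(x_1,\dots,x_k)$. A translation $I$ of a language $\mathcal L_1$ into a language $\mathcal L_2$ maps each $P(x_1,\dots,x_k)\in\mathcal L_1$ to an open formula $I(P)(x_1,\dots,x_k)$ of $\mathcal L_2$ in the same variables, and is extended to all open formulas by commuting with propositional connectives. For theories $T_1,T_2$ in $\mathcal L_1,\mathcal L_2$, a translation $I$ is an open interpretation of $T_1$ in $T_2$ if for every axiom $\forall\vec x A(\vec x)$ of $T_1$ we have $T_2\vdash\forall\vec x\, I(A)(\vec x)$. Interpretations compose in the obvious way. Two open interpretations $I_1,I_2$ of $T_1$ in $T_2$ are equivalent if $T_2\vdash\forall\vec x\,(I_1(P)(\vec x)\equiv I_2(P)(\vec x))$ for every $P\in\mathcal L_1$. The identity interpretation maps each $P$ to $P(x_1,\dots,x_k)$.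 *)

(* Defs.v *)
From Stdlib Require List.
From mathcomp Require Import all_boot.

Set Implicit Arguments.
Unset Strict Implicit.
Unset Printing Implicit Defensive.

Record language := Language {
  pred_sym :> finType;
  arity : pred_sym -> nat;
  arity_gt0 : forall P, 0 < arity P
}.

(* Open (quantifier-free) formulas with variables in V; [oform L 'I_n] is the
   type of open formulas F(x_0, ..., x_(n-1)). *)
Inductive oform (L : language) (V : Type) : Type :=
| OEq (x y : V)
| OPred (P : L) (v : (arity P).-tuple V)
| OBot
| OImp (A B : oform L V)
| OAnd (A B : oform L V)
| OOr (A B : oform L V).

Arguments OEq {L V} x y.
Arguments OPred {L V} P v.
Arguments OBot {L V}.

Definition ONot (L : language) (V : Type) (A : oform L V) : oform L V :=
  OImp A OBot.

Definition OIff (L : language) (V : Type) (A B : oform L V) : oform L V :=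
  OAnd (OImp A B) (OImp B A).

Fixpoint osubst (L : language) (V W : Type) (f : V -> W) (A : oform L V) :
    oform L W :=
  match A with
  | OEq x y => OEq (f x) (f y)
  | OPred P v => OPred P (map_tuple f v)
  | OBot => OBot
  | OImp A B => OImp (osubst f A) (osubst f B)
  | OAnd A B => OAnd (osubst f A) (osubst f B)
  | OOr A B => OOr (osubst f A) (osubst f B)
  end.

(* First-order formulas with de Bruijn indices.  There are no function symbols,
   so the terms are the variables and every substitution is a renaming. *)
Inductive form (L : language) : Type :=
| FEq (x y : nat)
| FPred (P : L) (v : (arity P).-tuple nat)
| FBot
| FImp (A B : form L)
| FAnd (A B : form L)
| FOr (A B : form L)
| FAll (A : form L)
| FEx (A : form L).

Arguments FEq {L} x y.
Arguments FPred {L} P v.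
Arguments FBot {L}.

Definition up (f : nat -> nat) (n : nat) : nat :=
  if n is m.+1 then (f m).+1 else 0.

Fixpoint subst (L : language) (f : nat -> nat) (A : form L) : form L :=
  match A with
  | FEq x y => FEq (f x) (f y)
  | FPred P v => FPred P (map_tuple f v)
  | FBot => FBot
  | FImp A B => FImp (subst f A) (subst f B)
  | FAnd A B => FAnd (subst f A) (subst f B)
  | FOr A B => FOr (subst f A) (subst f B)
  | FAll A => FAll (subst (up f) A)
  | FEx A => FEx (subst (up f) A)
  end.

Definition shift (L : language) (A : form L) : form L := subst succn A.

(* [inst x A] replaces index 0 of A by the variable x and lowers the others. *)
Definition inst (L : language) (x : nat) (A : form L) : form L :=
  subst (fun n => if n is m.+1 then m else x) A.

Fixpoint form_of_oform (L : language) (A : oform L nat) : form L :=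
  match A with
  | OEq x y => FEq x y
  | OPred P v => FPred P v
  | OBot => FBot
  | OImp A B => FImp (form_of_oform A) (form_of_oform B)
  | OAnd A B => FAnd (form_of_oform A) (form_of_oform B)
  | OOr A B => FOr (form_of_oform A) (form_of_oform B)
  end.

(* The sentence "for all x_0, ..., x_(n-1), A(x_0, ..., x_(n-1))"; the innermost
   quantifier binds x_0. *)
Definition univ (L : language) (n : nat) (A : oform L 'I_n) : form L :=
  iter n (@FAll L) (form_of_oform (osubst (@nat_of_ord n) A)).

(* A universal theory: [T n A] says that [univ A] is an axiom of T. *)
Definition theory (L : language) : Type := forall n : nat, oform L 'I_n -> Prop.

(* Natural deduction for classical first-order logic with equality, from the
   axioms of T and the hypotheses G. *)
Inductive deriv (L : language) (T : theory L) : seq (form L) -> form L -> Prop :=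
| DAx G n (A : oform L 'I_n) : T n A -> deriv T G (univ A)
| DHyp G A : List.In A G -> deriv T G A
| DRaa G A : deriv T (FImp A FBot :: G) FBot -> deriv T G A
| DImpI G A B : deriv T (A :: G) B -> deriv T G (FImp A B)
| DImpE G A B : deriv T G (FImp A B) -> deriv T G A -> deriv T G B
| DAndI G A B : deriv T G A -> deriv T G B -> deriv T G (FAnd A B)
| DAndE1 G A B : deriv T G (FAnd A B) -> deriv T G A
| DAndE2 G A B : deriv T G (FAnd A B) -> deriv T G B
| DOrI1 G A B : deriv T G A -> deriv T G (FOr A B)
| DOrI2 G A B : deriv T G B -> deriv T G (FOr A B)
| DOrE G A B C : deriv T G (FOr A B) ->
    deriv T (A :: G) C -> deriv T (B :: G) C -> deriv T G C
| DAllI G A : deriv T (map (@shift L) G) A -> deriv T G (FAll A)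
| DAllE G A x : deriv T G (FAll A) -> deriv T G (inst x A)
| DExI G A x : deriv T G (inst x A) -> deriv T G (FEx A)
| DExE G A B : deriv T G (FEx A) ->
    deriv T (A :: map (@shift L) G) (shift B) -> deriv T G B
| DEqRefl G x : deriv T G (FEq x x)
| DEqSubst G A x y : deriv T G (FEq x y) ->
    deriv T G (inst x A) -> deriv T G (inst y A).

Definition proves (L : language) (T : theory L) (A : form L) : Prop :=
  deriv T [::] A.

(* The atomic formula P(x_0, ..., x_(k-1)), k being the arity of P. *)
Definition atom (L : language) (P : L) : oform L 'I_(arity P) :=
  OPred P (ord_tuple (arity P)).

Definition canonical (L : language) (T : theory L) : Prop :=
  forall (P : L) (i j : 'I_(arity P)), i < j ->
    proves T (univ (OImp (OEq i j) (ONot (atom P)))).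

Definition translation (L1 L2 : language) : Type :=
  forall P : L1, oform L2 'I_(arity P).

Fixpoint translate (L1 L2 : language) (I : translation L1 L2) (V : Type)
    (A : oform L1 V) : oform L2 V :=
  match A with
  | OEq x y => OEq x y
  | OPred P v => osubst (tnth v) (I P)
  | OBot => OBot
  | OImp A B => OImp (translate I A) (translate I B)
  | OAnd A B => OAnd (translate I A) (translate I B)
  | OOr A B => OOr (translate I A) (translate I B)
  end.

Definition open_interpretation (L1 L2 : language) (T1 : theory L1)
    (T2 : theory L2) (I : translation L1 L2) : Prop :=
  forall (n : nat) (A : oform L1 'I_n), T1 n A -> proves T2 (univ (translate I A)).

Definition id_translation (L : language) : translation L L := @atom L.

(* [comp_translation J I] is "J after I". *)
Definition comp_translation (L1 L2 L3 : language) (J : translation L2 L3)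
    (I : translation L1 L2) : translation L1 L3 :=
  fun P => translate J (I P).

Definition equiv_translation (L1 L2 : language) (T2 : theory L2)
    (I1 I2 : translation L1 L2) : Prop :=
  forall P : L1, proves T2 (univ (OIff (I1 P) (I2 P))).

Definition isomorphic (L1 L2 : language) (T1 : theory L1) (T2 : theory L2) :
    Prop :=
  exists (I : translation L1 L2) (J : translation L2 L1),
    [/\ open_interpretation T1 T2 I,
        open_interpretation T2 T1 J,
        equiv_translation T1 (comp_translation J I) (@id_translation L1)
      & equiv_translation T2 (comp_translation I J) (@id_translation L2)].

(* Main.v *)
From Stdlib Require Import Classical.
From Stdlib Require List.
Require Import Defs.
From mathcomp Require Import all_boot.

Set Implicit Arguments.
Unset Strict Implicit.
Unset Printing Implicit Defensive.

(** Split each [P] according to which of its arguments coincide: for a map [f]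
    of the argument positions to themselves, the symbol [(P, f)] has one argument
    per element of the image of [f].  The translation [J] sends [(P, f)](y) to "the
    y's are distinct, and P holds of the y's placed according to [f]"; the
    translation [I] sends [P](x) to "for some [f], x_i = x_(f i) for all i, and
    [(P, f)] holds of the x's indexed by the image of [f]".  Many of these symbols
    are redundant, which is harmless because T' is taken to be the set of all
    sentences whose [J]-translation is provable in T.  With this T', everything
    reduces to the logical validity of J (I P) <-> P, and open valid formulas are
    derivable by a case distinction on the finitely many atoms that occur. *)

(** * Semantics of open formulas and translations *)

(* [eqv] need not be the equality of D, so that variables themselves can serve
   as elements of a model. *)
Record structure (L : language) (D : Type) := Structure {
  eqv : D -> D -> Prop;
  interp : forall P : L, (arity P).-tuple D -> Prop
}.

Record congruent (L : language) (D : Type) (M : structure L D) : Prop := Congruent {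
  eqv_refl : forall x, eqv M x x;
  eqv_sym : forall x y, eqv M x y -> eqv M y x;
  eqv_trans : forall x y z, eqv M x y -> eqv M y z -> eqv M x z;
  interp_congr : forall P (v w : (arity P).-tuple D),
    (forall i, eqv M (tnth v i) (tnth w i)) -> interp M v -> interp M w
}.

Fixpoint eval (L : language) (D V : Type) (M : structure L D) (rho : V -> D)
    (A : oform L V) : Prop :=
  match A with
  | OEq x y => eqv M (rho x) (rho y)
  | OPred P v => interp M (map_tuple rho v)
  | OBot => False
  | OImp A B => eval M rho A -> eval M rho B
  | OAnd A B => eval M rho A /\ eval M rho B
  | OOr A B => eval M rho A \/ eval M rho B
  end.

Lemma eval_eq_env (L : language) (D V : Type) (M : structure L D)
    (rho rho' : V -> D) (A : oform L V) :
  rho =1 rho' -> eval M rho A <-> eval M rho' A.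
Proof.
move=> e; elim: A => //= [x y|P v|A IHA B IHB|A IHA B IHB|A IHA B IHB]; try tauto.
- by rewrite !e.
- suff -> : map_tuple rho v = map_tuple rho' v by [].
  by apply: eq_from_tnth => i; rewrite !tnth_map e.
Qed.

Lemma eval_osubst (L : language) (D V W : Type) (M : structure L D)
    (rho : W -> D) (f : V -> W) (A : oform L V) :
  eval M rho (osubst f A) <-> eval M (rho \o f) A.
Proof.
elim: A => //= [P v|A IHA B IHB|A IHA B IHB|A IHA B IHB]; try tauto.
suff -> : map_tuple rho (map_tuple f v) = map_tuple (rho \o f) v by [].
by apply: eq_from_tnth => i; rewrite !tnth_map.
Qed.

Definition pullback (L1 L2 : language) (D : Type) (I : translation L1 L2)
    (M : structure L2 D) : structure L1 D :=
  Structure (eqv M) (fun P v => eval M (tnth v) (I P)).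

Lemma eval_translate (L1 L2 : language) (D V : Type) (I : translation L1 L2)
    (M : structure L2 D) (rho : V -> D) (A : oform L1 V) :
  eval M rho (translate I A) <-> eval (pullback I M) rho A.
Proof.
elim: A => //= [P v|A IHA B IHB|A IHA B IHB|A IHA B IHB]; try tauto.
by rewrite eval_osubst; apply: eval_eq_env => i /=; rewrite tnth_map.
Qed.

Lemma eval_translate_atom (L1 L2 : language) (D : Type) (I : translation L1 L2)
    (M : structure L2 D) (P : L1) (rho : 'I_(arity P) -> D) :
  eval M rho (translate I (atom P)) <-> eval M rho (I P).
Proof.
rewrite /= eval_osubst; apply: eval_eq_env => i /=.
by rewrite tnth_ord_tuple.
Qed.

Lemma eval_eq_interp (L : language) (D V : Type) (e : D -> D -> Prop)
    (r r' : forall P : L, (arity P).-tuple D -> Prop) (rho : V -> D)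
    (A : oform L V) :
  (forall P v, r P v <-> r' P v) ->
  eval (Structure e r) rho A <-> eval (Structure e r') rho A.
Proof.
by move=> rr'; elim: A => //= [A IHA B IHB|A IHA B IHB|A IHA B IHB]; tauto.
Qed.

Section FiniteConnectives.

Variables (L : language) (V : Type) (T : finType).

Definition OBigAnd (F : T -> oform L V) : oform L V :=
  foldr (fun t => OAnd (F t)) (ONot OBot) (enum T).

Definition OBigOr (F : T -> oform L V) : oform L V :=
  foldr (fun t => OOr (F t)) OBot (enum T).

Variables (D : Type) (M : structure L D) (rho : V -> D).

Lemma eval_OBigAnd (F : T -> oform L V) :
  eval M rho (OBigAnd F) <-> forall t, eval M rho (F t).
Proof.
rewrite /OBigAnd; have -> : (forall t, eval M rho (F t)) <->
    (forall t, t \in enum T -> eval M rho (F t)).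
  by split=> h t; [move=> _|]; apply: h; rewrite ?mem_enum.
elim: (enum T) => [|t s IHs] /=; first by split.
split=> [[Ft /IHs Fs] u|Fts].
  by rewrite inE => /orP[/eqP->|/Fs].
split; first by apply: Fts; rewrite mem_head.
by apply/IHs => u us; apply: Fts; rewrite inE us orbT.
Qed.

Lemma eval_OBigOr (F : T -> oform L V) :
  eval M rho (OBigOr F) <-> exists t, eval M rho (F t).
Proof.
rewrite /OBigOr; have -> : (exists t, eval M rho (F t)) <->
    (exists2 t, t \in enum T & eval M rho (F t)).
  by split=> [[t Ft]|[t _ Ft]]; exists t; rewrite ?mem_enum.
elim: (enum T) => [|t s IHs] /=; first by split=> // -[].
split=> [[Ft|/IHs[u us Fu]]|[u]].
- by exists t; rewrite ?mem_head.
- by exists u; rewrite // inE us orbT.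
- by rewrite inE => /orP[/eqP->|us Fu]; [left|right; apply/IHs; exists u].
Qed.

End FiniteConnectives.

(** * Structural rules and case distinction *)

Section Derivations.

Variables (L : language) (T : theory L).
Implicit Types (G : seq (form L)) (A B : form L).

Lemma deriv_weaken G H A : List.incl G H -> deriv T G A -> deriv T H A.
Proof.
move=> GH d; elim: d H GH => {G A}.
- by move=> G n A TA H _; apply: DAx.
- by move=> G A GA H GH; apply: DHyp; apply: GH.
- move=> G A _ IH H GH; apply: DRaa; apply: IH.
  by apply: List.incl_cons; [left|apply: List.incl_tl].
- move=> G A B _ IH H GH; apply: DImpI; apply: IH.
  by apply: List.incl_cons; [left|apply: List.incl_tl].
- by move=> G A B _ IH1 _ IH2 H GH; apply: DImpE (IH1 _ GH) (IH2 _ GH).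
- by move=> G A B _ IH1 _ IH2 H GH; apply: DAndI; [apply: IH1|apply: IH2].
- by move=> G A B _ IH H GH; apply: DAndE1 (IH _ GH).
- by move=> G A B _ IH H GH; apply: DAndE2 (IH _ GH).
- by move=> G A B _ IH H GH; apply: DOrI1; apply: IH.
- by move=> G A B _ IH H GH; apply: DOrI2; apply: IH.
- move=> G A B C _ IH _ IHA _ IHB H GH; apply: DOrE (IH _ GH) _ _.
    by apply: IHA; apply: List.incl_cons; [left|apply: List.incl_tl].
  by apply: IHB; apply: List.incl_cons; [left|apply: List.incl_tl].
- by move=> G A _ IH H GH; apply: DAllI; apply: IH; apply: List.incl_map.
- by move=> G A x _ IH H GH; apply: DAllE; apply: IH.
- by move=> G A x _ IH H GH; apply: (@DExI _ _ _ _ x); apply: IH.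
- move=> G A B _ IH _ IHB H GH; apply: DExE (IH _ GH) _; apply: IHB.
  apply: List.incl_cons; first by left.
  by apply: List.incl_tl; apply: List.incl_map.
- by move=> G x H _; apply: DEqRefl.
- by move=> G A x y _ IH1 _ IH2 H GH; apply: DEqSubst (IH1 _ GH) (IH2 _ GH).
Qed.

Lemma deriv_weaken1 G A B : deriv T G B -> deriv T (A :: G) B.
Proof. by apply: deriv_weaken; apply: List.incl_tl. Qed.

Lemma deriv_hyp0 G A : deriv T (A :: G) A.
Proof. by apply: DHyp; left. Qed.

Lemma deriv_exfalso G A : deriv T G FBot -> deriv T G A.
Proof. by move=> d; apply: DRaa; apply: deriv_weaken1. Qed.

Lemma deriv_cases G A B :
  deriv T (A :: G) B -> deriv T (FImp A FBot :: G) B -> deriv T G B.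
Proof.
(* Excluded middle for [A] is derived by refuting its negation. *)
apply: DOrE; apply: DRaa; apply: (DImpE (deriv_hyp0 _ _)).
apply: DOrI2; apply: DImpI; apply: DImpE; first by apply: DHyp; right; left.
by apply: DOrI1; apply: deriv_hyp0.
Qed.

(** Iterated case distinction: each [H] that occurs is [G] with, for every member of [s], either
    that formula or its negation added. *)
Lemma deriv_decide (s : seq (form L)) G B :
  (forall H, List.incl G H ->
    (forall A, List.In A s -> deriv T H A \/ deriv T H (FImp A FBot)) ->
    deriv T H B) ->
  deriv T G B.
Proof.
elim: s G => [|A s IHs] G hB; first by apply: hB.
apply: (@deriv_cases _ A); apply: IHs => H GH Hs; apply: hB => [C CG|C [<-|/Hs//]].
- by apply: GH; right.
- by left; apply: DHyp; apply: GH; left.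
- by apply: GH; right.
- by right; apply: DHyp; apply: GH; left.
Qed.

(** * Renamings and universal closures *)

Lemma eq_subst f g A : f =1 g -> subst f A = subst g A.
Proof.
have eq_up h k : h =1 k -> up h =1 up k by move=> e [|n] //=; rewrite e.
elim: A f g => //=
  [x y|P v|A IHA B IHB|A IHA B IHB|A IHA B IHB|A IHA|A IHA] f g e.
- by rewrite !e.
- by congr FPred; apply: eq_from_tnth => i; rewrite !tnth_map.
- by rewrite (IHA _ g) ?(IHB _ g).
- by rewrite (IHA _ g) ?(IHB _ g).
- by rewrite (IHA _ g) ?(IHB _ g).
- by rewrite (IHA _ (up g)) //; apply: eq_up.
- by rewrite (IHA _ (up g)) //; apply: eq_up.
Qed.

Lemma subst_id A : subst id A = A.
Proof.
have up_id : up id =1 id by case.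
elim: A => //= [P v|A -> B ->|A -> B ->|A -> B ->|A IHA|A IHA] //.
- by congr FPred; apply: eq_from_tnth => i; rewrite tnth_map.
- by rewrite (eq_subst _ up_id) IHA.
- by rewrite (eq_subst _ up_id) IHA.
Qed.

Lemma subst_comp f g A : subst g (subst f A) = subst (g \o f) A.
Proof.
have up_comp h k : up k \o up h =1 up (k \o h) by case.
elim: A f g => //=
  [P v|A IHA B IHB|A IHA B IHB|A IHA B IHB|A IHA|A IHA] f g.
- by congr FPred; apply: eq_from_tnth => i; rewrite !tnth_map.
- by rewrite IHA IHB.
- by rewrite IHA IHB.
- by rewrite IHA IHB.
- by rewrite IHA (eq_subst _ (up_comp _ _)).
- by rewrite IHA (eq_subst _ (up_comp _ _)).
Qed.

(** The outermost of [n] quantifiers binds index [n - 1], so eliminations consume [t] from the top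
    down. The renaming [f] of the ambient variables is kept general because each elimination changes
    it: the new one sends 0 to the chosen term and [m.+1] to [f m]. *)
Lemma deriv_all_elim n G A (f t : nat -> nat) :
  deriv T G (subst f (iter n (@FAll L) A)) ->
  deriv T G (subst (fun i => if i < n then t i else f (i - n)) A).
Proof.
elim: n f => [|n IHn] f /= d.
  by rewrite (@eq_subst _ f) // => i; rewrite subn0.
move: (DAllE (t n) d); rewrite /inst subst_comp => /IHn.
rewrite (@eq_subst _ (fun i => if i < n.+1 then t i else f (i - n.+1))) // => i /=.
rewrite ltnS; case: (ltngtP i n) => [//|ni|->]; last by rewrite subnn.
by rewrite subnS; case: (i - n) (subn_gt0 n i) => //; rewrite ni.
Qed.

Lemma deriv_all_intro n A : deriv T [::] A -> deriv T [::] (iter n (@FAll L) A).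
Proof. by move=> d; elim: n => //= n IHn; apply: DAllI. Qed.

Lemma form_of_osubst V (f : V -> nat) (g : nat -> nat) (A : oform L V) :
  subst g (form_of_oform (osubst f A)) = form_of_oform (osubst (g \o f) A).
Proof.
elim: A => //= [P v|A -> B ->|A -> B ->|A -> B ->] //.
by congr FPred; apply: eq_from_tnth => i; rewrite !tnth_map.
Qed.

Lemma eq_osubst V W (f g : V -> W) (A : oform L V) :
  f =1 g -> osubst f A = osubst g A.
Proof.
move=> e; elim: A => //= [x y|P v|A -> B ->|A -> B ->|A -> B ->] //.
- by rewrite !e.
- by congr OPred; apply: eq_from_tnth => i; rewrite !tnth_map.
Qed.

(** Instantiating each bound variable by itself recovers the matrix. Conversely, generalization is
    unrestricted because the context is empty. *)
Lemma proves_univ n (A : oform L 'I_n) :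
  proves T (univ A) <-> proves T (form_of_oform (osubst (@nat_of_ord n) A)).
Proof.
split; last exact: deriv_all_intro.
rewrite /proves /univ -[iter _ _ _]subst_id => /(deriv_all_elim id).
rewrite form_of_osubst (@eq_osubst _ _ _ (@nat_of_ord n)) // => i /=.
by rewrite ltn_ord.
Qed.

(** * Equality and completeness for open formulas *)

Lemma deriv_eq_sym G x y : deriv T G (FEq x y) -> deriv T G (FEq y x).
Proof.
by move=> xy; apply: (DEqSubst (A := FEq 0 x.+1) xy); apply: DEqRefl.
Qed.

Lemma deriv_eq_trans G x y z :
  deriv T G (FEq x y) -> deriv T G (FEq y z) -> deriv T G (FEq x z).
Proof. by move=> xy yz; apply: (DEqSubst (A := FEq x.+1 0) yz). Qed.

(** [DEqSubst] replaces one variable at a time, so the arguments are exchanged one by one: [u n] has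
    its first [n] entries from [w] and the others from [v]. *)
Lemma deriv_pred_congr G (P : L) (v w : (arity P).-tuple nat) :
  (forall i, deriv T G (FEq (tnth v i) (tnth w i))) ->
  deriv T G (FPred P v) -> deriv T G (FPred P w).
Proof.
move=> vw Pv.
pose u n := [tuple if i < n then tnth w i else tnth v i | i < arity P].
suff Pu n : n <= arity P -> deriv T G (FPred P (u n)).
  rewrite (_ : w = u (arity P)); first exact: Pu.
  by apply: eq_from_tnth => i; rewrite tnth_mktuple ltn_ord.
elim: n => [_|n IHn nP].
  rewrite (_ : u 0 = v) //.
  by apply: eq_from_tnth => i; rewrite tnth_mktuple.
pose j := Ordinal nP.
(* Index 0 marks the slot [j] to be replaced; the other arguments are shifted so that [inst]
   restores them. *)
pose A := FPred P [tuple if i == j then 0 else (tnth (u n) i).+1 | i < arity P].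
have -> : FPred P (u n.+1) = inst (tnth w j) A.
  congr FPred; apply: eq_from_tnth => i.
  rewrite [RHS]tnth_map !tnth_mktuple ltnS.
  case: eqVneq => [->|]; first by rewrite leqnn.
  by rewrite -val_eqE /= ltn_neqAle => ->.
apply: DEqSubst (vw j) _.
rewrite (_ : inst _ _ = FPred P (u n)); first by apply: IHn; apply: ltnW.
congr FPred; apply: eq_from_tnth => i; rewrite [LHS]tnth_map !tnth_mktuple.
by case: eqVneq => [->|//]; rewrite /= ltnn.
Qed.

Definition term_structure G : structure L nat :=
  Structure (fun x y => deriv T G (FEq x y)) (fun P v => deriv T G (FPred P v)).

Lemma term_structure_congruent G : congruent (term_structure G).
Proof.
split=> /= [x|x y|x y z|P v w].
- exact: DEqRefl.
- exact: deriv_eq_sym.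
- exact: deriv_eq_trans.
- exact: deriv_pred_congr.
Qed.

Fixpoint atoms (A : oform L nat) : seq (form L) :=
  match A with
  | OEq x y => [:: FEq x y]
  | OPred P v => [:: FPred P v]
  | OBot => [::]
  | OImp A B | OAnd A B | OOr A B => atoms A ++ atoms B
  end.

(** Truth lemma: on atoms, truth in the term structure is derivability by definition, and a context
    deciding the atoms decides every formula built from them. Both signs are proved together because
    an implication needs the negative case of its premise. *)
Lemma deriv_truth G (A : oform L nat) :
  (forall C, List.In C (atoms A) -> deriv T G C \/ deriv T G (FImp C FBot)) ->
  (eval (term_structure G) id A -> deriv T G (form_of_oform A)) /\
  (~ eval (term_structure G) id A -> deriv T G (FImp (form_of_oform A) FBot)).
Proof.
elim: A => [x y|P v||A IHA B IHB|A IHA B IHB|A IHA B IHB] /= dec.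
- by split=> // nxy; case: (dec (FEq x y)) => //; left.
- have -> : map_tuple id v = v by apply: eq_from_tnth => i; rewrite tnth_map.
  by split=> // nPv; case: (dec (FPred P v)) => //; left.
- by split=> // _; apply: DImpI; apply: deriv_hyp0.
- case: IHA => [C CA|tA fA]; first by apply: dec; apply: List.in_or_app; left.
  case: IHB => [C CB|tB fB]; first by apply: dec; apply: List.in_or_app; right.
  split=> [AB|nAB].
    case: (classic (eval (term_structure G) id A)) => [/AB/tB dB|/fA dA].
      by apply: DImpI; apply: deriv_weaken1.
    apply: DImpI; apply: deriv_exfalso.
    by apply: DImpE (deriv_weaken1 _ dA) (deriv_hyp0 _ _).
  have [/tA dA /fB dB] := imply_to_and _ _ nAB.
  apply: DImpI; apply: DImpE (deriv_weaken1 _ dB) _.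
  by apply: DImpE (deriv_hyp0 _ _) (deriv_weaken1 _ dA).
- case: IHA => [C CA|tA fA]; first by apply: dec; apply: List.in_or_app; left.
  case: IHB => [C CB|tB fB]; first by apply: dec; apply: List.in_or_app; right.
  split=> [[/tA dA /tB dB]|/not_and_or[/fA dA|/fB dB]]; first exact: DAndI.
    by apply: DImpI; apply: DImpE (deriv_weaken1 _ dA) (DAndE1 (deriv_hyp0 _ _)).
  by apply: DImpI; apply: DImpE (deriv_weaken1 _ dB) (DAndE2 (deriv_hyp0 _ _)).
- case: IHA => [C CA|tA fA]; first by apply: dec; apply: List.in_or_app; left.
  case: IHB => [C CB|tB fB]; first by apply: dec; apply: List.in_or_app; right.
  split=> [[/tA dA|/tB dB]|/not_or_and[/fA dA /fB dB]].
  + exact: DOrI1.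
  + exact: DOrI2.
  apply: DImpI; apply: DOrE (deriv_hyp0 _ _) _ _.
    by apply: DImpE (deriv_weaken1 _ (deriv_weaken1 _ dA)) (deriv_hyp0 _ _).
  by apply: DImpE (deriv_weaken1 _ (deriv_weaken1 _ dB)) (deriv_hyp0 _ _).
Qed.

(** Completeness without a Henkin construction: no quantifier has to be witnessed, so it is enough
    to decide the finitely many atoms of [A] and use the term structure of each resulting
    context. *)
Lemma deriv_valid G (A : oform L nat) :
  (forall M : structure L nat, congruent M -> eval M id A) ->
  deriv T G (form_of_oform A).
Proof.
move=> vA; apply: (@deriv_decide (atoms A)) => H _ /deriv_truth[tA _].
by apply: tA; apply: vA; apply: term_structure_congruent.
Qed.

Lemma proves_entails n (A B : oform L 'I_n) :
  (forall (M : structure L nat) rho, congruent M ->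
    eval M rho A -> eval M rho B) ->
  proves T (univ A) -> proves T (univ B).
Proof.
move=> AB /proves_univ dA; apply/proves_univ; apply: DImpE dA.
apply: (@deriv_valid [::] (OImp (osubst _ A) (osubst _ B))) => M cM /=.
by rewrite !eval_osubst; apply: AB.
Qed.

Lemma proves_valid n (A : oform L 'I_n) :
  (forall (M : structure L nat) rho, congruent M -> eval M rho A) ->
  proves T (univ A).
Proof.
move=> vA; apply/proves_univ; apply: deriv_valid => M cM.
by apply/eval_osubst; apply: vA.
Qed.

End Derivations.

(** * The split language and its two translations *)

Section Canonization.

Variable L : language.

Definition split_sym : finType :=
  {P : L & {ffun 'I_(arity P) -> 'I_(arity P)}}.

Definition positions (Q : split_sym) : {set 'I_(arity (tag Q))} :=
  tagged Q @: [set: 'I_(arity (tag Q))].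

Lemma positions_gt0 (Q : split_sym) : 0 < #|positions Q|.
Proof.
apply/card_gt0P; exists (tagged Q (Ordinal (arity_gt0 (tag Q)))).
by rewrite imset_f.
Qed.

Definition split_language : language := Language positions_gt0.

Lemma tagged_positions (Q : split_sym) i : tagged Q i \in positions Q.
Proof. exact: imset_f. Qed.

(** The argument place of [Q] that supplies the value of the original position [i]. *)
Definition rank (Q : split_sym) (i : 'I_(arity (tag Q))) : 'I_#|positions Q| :=
  enum_rank_in (tagged_positions i) (tagged Q i).

Lemma enum_val_rank (Q : split_sym) i : enum_val (rank (Q := Q) i) = tagged Q i.
Proof. by rewrite enum_rankK_in ?tagged_positions. Qed.

Definition ODistinct (L' : language) n : oform L' 'I_n :=
  OBigAnd (fun p : 'I_n * 'I_n =>
    if p.1 == p.2 then ONot OBot else ONot (OEq p.1 p.2)).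

Lemma eval_ODistinct (L' : language) n D (M : structure L' D) (rho : 'I_n -> D) :
  eval M rho (ODistinct L' n) <->
  forall i j, i != j -> ~ eqv M (rho i) (rho j).
Proof.
rewrite eval_OBigAnd; split=> [d i j ij|d [i j]].
  by have := d (i, j); rewrite /= (negbTE ij).
by rewrite /=; case: eqVneq => //= ij; apply: d.
Qed.

Definition from_split : translation split_language L := fun Q : split_sym =>
  OAnd (ODistinct L #|positions Q|) (OPred (tag Q) (mktuple (rank (Q := Q)))).

Definition to_split : translation L split_language := fun P =>
  OBigOr (fun f : {ffun 'I_(arity P) -> 'I_(arity P)} =>
    OAnd (OBigAnd (fun i => OEq i (f i)))
      (OPred (L := split_language) (Tagged _ f : split_sym)
         (mktuple (fun a => enum_val a)))).

(** [f] sends each position to the position picked from its class; equivalent positions have the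
    same class and hence the same pick. *)
Lemma representatives (D : Type) (e : D -> D -> Prop) n (v : 'I_n -> D) :
  (forall x, e x x) -> (forall x y, e x y -> e y x) ->
  (forall x y z, e x y -> e y z -> e x z) ->
  exists f : {ffun 'I_n -> 'I_n},
    (forall i, e (v i) (v (f i))) /\
    (forall i j, e (v (f i)) (v (f j)) -> f i = f j).
Proof.
move=> er es et.
(* [pick] needs a boolean relation; as there are finitely many pairs, excluded middle gives one
   without an axiom of choice. *)
have [c cP] : exists c : 'I_n * 'I_n -> bool, forall p, c p <-> e (v p.1) (v p.2).
  apply: (@fin_all_exists _ (fun=> bool) (fun p x => x <-> e (v p.1) (v p.2))) => p.
  by case: (classic (e (v p.1) (v p.2))) => ?; [exists true|exists false].
pose b i j := c (i, j).
have bP i j : reflect (e (v i) (v j)) (b i j).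
  by apply: (iffP idP) => [/cP|h]; last apply/cP.
pose f := [ffun i => odflt i [pick j | b i j]].
have ef i : e (v i) (v (f i)).
  by rewrite ffunE; case: pickP => [j /bP //|_] /=; apply: er.
exists f; split=> // i j fij.
have eij : e (v i) (v j) by apply: et (ef i) (et _ _ _ fij (es _ _ (ef j))).
have bij : b i =1 b j.
  move=> k; apply/bP/bP; first by apply: et; apply: es.
  exact: et.
(* The defaults [i] and [j] differ, so an empty pick must be excluded: [j] lies in its own class. *)
rewrite !ffunE (eq_pick bij); case: pickP => // /(_ j) /bP[].
exact: er.
Qed.

(** Any disjunct [f] that holds has x_i = x_(f i), so congruence gives P(x). Conversely, the [f] of
    [representatives] selects one position per class, which makes the arguments of [(P, f)]
    distinct. *)
Lemma eval_from_to_split (D : Type) (M : structure L D) (P : L)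
    (v : (arity P).-tuple D) : congruent M ->
  eval (pullback from_split M) (tnth v) (to_split P) <-> interp M v.
Proof.
move=> cM; rewrite eval_OBigOr.
(* Through both translations, position [i] of [P] receives the argument at [f i]. *)
have val_tup (f : {ffun 'I_(arity P) -> 'I_(arity P)}) i :
    tnth (map_tuple (tnth (map_tuple (tnth v) (mktuple (fun a => enum_val a))))
            (mktuple (rank (Q := Tagged _ f)))) i = tnth v (f i).
  rewrite !tnth_map !tnth_ord_tuple; congr (tnth v _).
  exact: (@enum_val_rank (Tagged _ f) i).
split=> [[f]|Pv].
  rewrite [X in X -> _]/= => -[/eval_OBigAnd /= vf [_]].
  by apply: (interp_congr cM) => i; rewrite val_tup; apply: eqv_sym.
have [f [vf f_inj]] := representatives (tnth v) (eqv_refl cM)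
  (@eqv_sym _ _ _ cM) (@eqv_trans _ _ _ cM).
exists f; rewrite /=; split; first by apply/eval_OBigAnd.
split; last by apply: (interp_congr cM) Pv => i; rewrite val_tup.
apply/eval_ODistinct => a b; rewrite !tnth_map !tnth_ord_tuple.
move=> ab eab; case/eqP: ab; apply: enum_val_inj.
move: (enum_valP a) (enum_valP b) eab.
by move=> /imsetP[i _ ->] /imsetP[j _ ->] /f_inj.
Qed.

Lemma eval_from_to_translate (V D : Type) (M : structure L D) (rho : V -> D)
    (A : oform L V) : congruent M ->
  eval M rho (translate from_split (translate to_split A)) <-> eval M rho A.
Proof.
move=> cM; rewrite !eval_translate; case: M cM => e r cM.
by apply: eval_eq_interp => P v; apply: (eval_from_to_split v cM).
Qed.

(** * The canonical theory and the isomorphism *)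

Variable T : theory L.

Definition split_theory : theory split_language :=
  fun n A => proves T (univ (translate from_split A)).

(** The translated sentence is valid outright: distinctness of the arguments is a conjunct of
    [from_split]. *)
Lemma split_theory_canonical : canonical split_theory.
Proof.
move=> Q i j ij; apply: DAx; apply: proves_valid => M rho cM /=.
move=> eij [] /eval_osubst /eval_ODistinct d _.
by apply: (d i j); rewrite ?neq_ltn ?ij //= !tnth_ord_tuple.
Qed.

Lemma split_theory_isomorphic : isomorphic T split_theory.
Proof.
exists to_split, from_split; split.
- move=> n A TA; apply: DAx; apply: proves_entails (DAx _ TA) => M rho cM.
  by rewrite eval_from_to_translate.
- move=> n A T'A; exact: T'A.
- move=> P; apply: proves_valid => M rho cM.
  have := eval_from_to_translate rho (atom P) cM.
  by rewrite eval_translate eval_translate_atom -eval_translate; case.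
(* Membership in [split_theory] applies [from_split] once more, so the claim becomes J I J (Q) <-> J
   (Q): the validity of J I A <-> A for the formula A = [from_split Q]. *)
- move=> Q; apply: DAx; apply: proves_valid => M rho cM.
  have := eval_from_to_translate rho (from_split Q) cM.
  by rewrite -(eval_translate_atom from_split M (P := Q)); case.
Qed.

End Canonization.

Theorem theorem2p18 (L : language) (T : theory L) :
  exists (L' : language) (T' : theory L'), canonical T' /\ isomorphic T T'.
Proof.
exists (split_language L), (split_theory T); split.
- exact: split_theory_canonical.
- exact: split_theory_isomorphic.
Qed.
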